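(* Let $0\le\theta_0<\theta_1<\cdots<\theta_{q-1}$ be fixed integers. Then the function $\beta\mapsto\dim_H\bigl(C_{\beta;\theta_0\cdots\theta_{q-1}}\bigr)$ is continuous on the set of real numbers $\beta>2$ with $\beta>\theta_{q-1}$.
   Context: $\beta$-expansions: for real $\beta>1$ let $T_\beta:[0,1)\to[0,1)$, $T_\beta x=\beta x-\lfloor\beta x\rfloor$. For $x\in[0,1)$ put $a_k=\lfloor\beta\,T_\beta^{k-1}x\rfloor$, $k\ge1$; then $x=\sum_{k\ge1}a_k\beta^{-k}$, and $(a_1,a_2,\dots)$ is called the $\beta$-expansion of $x$. For real $\beta>2$ and integers $0\le\theta_0<\cdots<\theta_{q-1}\le\lfloor\beta\rfloor$, $C_{\beta;\theta_0\cdots\theta_{q-1}}$ is the closure in $\mathbb R$ of the set of all $x\in[0,1)$ whose $\beta$-expansion has all its digits $a_k$ in $\{\theta_0,\dots,\theta_{q-1}\}$. $\dim_H$ is Hausdorff dimension. *)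

(* Defs.v *)
From HB Require Import structures.
From mathcomp Require Import all_boot all_order all_algebra.
From mathcomp Require Import all_classical all_reals all_analysis.
Set Implicit Arguments.
Unset Strict Implicit.
Unset Printing Implicit Defensive.
Import Order.TTheory GRing.Theory Num.Theory.
Import numFieldNormedType.Exports.
Local Open Scope classical_set_scope.
Local Open Scope ring_scope.

Definition beta_map (R : realType) (b x : R) : R :=
  b * x - (Num.floor (b * x))%:~R.

(* The digits are numbered from 1; index 0 is junk and is never used. *)
Definition beta_digit (R : realType) (b x : R) (k : nat) : int :=
  Num.floor (b * iter k.-1 (beta_map b) x).

(* The digits theta_0, ..., theta_(q-1) are indexed by 'I_q. *)
Definition beta_cantor (R : realType) (b : R) (q : nat) (theta : 'I_q -> int)
    : set R :=
  closure [set x : R | 0 <= x < 1 /\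
    forall k : nat, (1 <= k)%N -> exists i : 'I_q, beta_digit b x k = theta i].

(* -oo on the empty set; only used below for nonempty sets, or in an upper
   bound that the empty set satisfies anyway. *)
Definition diameter (R : realType) (A : set R) : \bar R :=
  ereal_sup [set `|p.1 - p.2|%:E | p in A `*` A].

(* Empty pieces of a cover contribute 0 for every s, including s = 0, where a
   nonempty piece contributes 1 even if it is a single point (0 `^ 0 = 1). *)
Definition hausdorff_content (R : realType) (s d : R) (A : set R) : \bar R :=
  ereal_inf [set (\sum_(0 <= i <oo | U i != set0) diameter (U i) `^ s)%E
    | U in [set U : nat -> set R |
        A `<=` \bigcup_i U i /\ forall i, (diameter (U i) <= d%:E)%E]].

Definition hausdorff_measure (R : realType) (s : R) (A : set R) : \bar R :=
  ereal_sup [set hausdorff_content s d A | d in [set d : R | 0 < d]].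

(* The dimension of the empty set is 0. *)
Definition hausdorff_dim (R : realType) (A : set R) : \bar R :=
  ereal_inf [set s%:E | s in [set s : R | 0 <= s /\ hausdorff_measure s A = 0%E]].

(* Main.v *)
Require Import Defs.
From HB Require Import structures.
From mathcomp Require Import all_boot all_order all_algebra.
From mathcomp Require Import all_classical all_reals all_analysis.
From mathcomp Require Import ring lra zify.
Set Implicit Arguments.
Unset Strict Implicit.
Unset Printing Implicit Defensive.
Import Order.TTheory GRing.Theory Num.Theory.
Import numFieldNormedType.Exports.
Local Open Scope classical_set_scope.
Local Open Scope ring_scope.

(** Fix a finite set [A] of nonnegative digits and a base [b > 1], and give a
    word [w = w_1 ... w_n] over [A] the value [sum_i w_i b^-i].  The digit words
    of actual expansions are controlled by two finite conditions on values:

    - [admissible]: every suffix has value at most 1.  Each prefix of a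
      b-expansion is admissible.
    - [full]: every nonempty suffix has value less than [1 - b^-length].  A full
      word may be followed by any expansion, so full words of one length can be
      concatenated freely.

    Let [N_n] and [F_n] be the numbers of admissible and of full words of
    length [n].  The dimension [D] of the Cantor set is squeezed between their
    growth rates.  Cylinders of order [k * n] give [D <= s] as soon as
    [N_n < b^(s n)] for a single [n] ([hausdorff_dim_le_count]), because
    [N_(k n) <= N_n ^ k].  Dually [F_n > b^(s n)] for a single [n > 0] gives
    [D >= s] ([hausdorff_dim_ge_count]): the Cantor set contains the attractor
    of [F_n] similarities of ratio [b^-n] with non-overlapping images, and the
    base-[F_n] expansion of numbers of [[0, 1)] maps [[0, 1)] into that attractor,
    with an inverse that is Hoelder of exponent [s], so that a cover of the Cantor
    set with small s-sum would produce a cover of [[0, 1)] of small total length.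

    The two rates agree.  Cutting an admissible word before its longest critical
    suffix, one with value at least [1 - b^-length], leaves a full word
    ([admissible_split]), and there are at most [2 (l + 1)] critical words of
    length [l], because at most [l + 1] admissible words of length [l] have
    their values in a half-open window of length [b^-l] ([count_windowed]).
    Hence, for [c >= 1], [F_k <= c^k] for all [k] implies [N_n <= 2 (n + 1)^2 c^n].

    Continuity is then a matter of finitely many inequalities.  For [n] fixed
    and [c] near [b], no admissible word appears and no full word disappears
    when [b] moves to [c]: non-admissibility and fullness are strict
    inequalities between continuous functions of the base.  So
    [N_n < b^(s n)] and [F_n > b^(s n)] persist near [b], which gives upper and
    lower semicontinuity of [D].  Because admissibility uses the non-strict
    bound 1, this covers without distinction the bases at which the expansion
    of 1 terminates and the set of expansions jumps. *)

(** * Words over a digit set *)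

Fixpoint words (T : Type) (A : seq T) (n : nat) : seq (seq T) :=
  if n is n'.+1 then [seq d :: w | d <- A, w <- words A n'] else [:: [::]].

Lemma mem_words (T : eqType) (A : seq T) n w :
  (w \in words A n) = (size w == n) && all [in A] w.
Proof.
elim: n w => [|n IH] w /=; first by rewrite inE; case: w.
apply/allpairsP/andP => [[[d u] /= [dA]]|[]].
  by rewrite IH => /andP[/eqP <- uA] ->; rewrite /= eqxx dA.
case: w => // d u /=; rewrite eqSS => us /andP[dA uA].
by exists (d, u); rewrite /= IH us uA.
Qed.

Lemma uniq_words (T : eqType) (A : seq T) n : uniq A -> uniq (words A n).
Proof.
move=> uA; elim: n => //= n IH; apply: allpairs_uniq => //.
by move=> [a u] [c v] _ _ /= [-> ->].
Qed.

Lemma size_words (T : eqType) (A : seq T) n :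
  size (words A n) = (size A ^ n)%N.
Proof. by elim: n => //= n IH; rewrite size_allpairs IH expnS. Qed.

(** * Admissible and full words *)

Section WordValues.
Variable R : realFieldType.
Implicit Types (b x y : R) (u s t w : seq int).

Definition wval b w : R := foldr (fun d v => (d%:~R + v) / b) 0 w.

Fixpoint admissible b w : bool :=
  if w is _ :: w' then (wval b w <= 1) && admissible b w' else true.

Fixpoint full b w : bool :=
  if w is _ :: w' then (wval b w + b ^- size w < 1) && full b w' else true.

Definition nonneg_word w := all (fun d => 0 <= d) w.

Variable b : R.
Hypothesis b_gt1 : 1 < b.

Lemma base_gt0 : 0 < b. Proof. exact: lt_trans b_gt1. Qed.

Lemma invbX_gt0 n : 0 < b ^- n.
Proof. by rewrite invr_gt0 exprn_gt0 ?base_gt0. Qed.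

Lemma invbX_le1 n : b ^- n <= 1.
Proof. by rewrite invf_le1 ?exprn_gt0 ?base_gt0// exprn_ege1// ltW. Qed.

Lemma invbXS n : b ^- n.+1 = b ^- n / b.
Proof. by rewrite exprSr invfM mulrC. Qed.

Lemma wval_cons d w : wval b (d :: w) = (d%:~R + wval b w) / b.
Proof. by []. Qed.

Lemma wval_cat u s : wval b (u ++ s) = wval b u + b ^- size u * wval b s.
Proof.
elim: u => [|d u IH] /=; first by rewrite expr0 invr1 mul1r add0r.
rewrite IH invbXS; ring.
Qed.

Lemma wval_ge0 w : nonneg_word w -> 0 <= wval b w.
Proof.
elim: w => //= d w IH /andP[d0 /IH w0].
by rewrite divr_ge0 ?addr_ge0 ?ler0z// ltW// base_gt0.
Qed.

Lemma wval_le1 w : admissible b w -> wval b w <= 1.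
Proof. by case: w => [|d w] /=; [rewrite ler01|move=> /andP[]]. Qed.

Lemma full_wval w : full b w -> wval b w <= 1 - b ^- size w.
Proof.
case: w => [|d w]; first by rewrite /= expr0 invr1 subrr.
by move=> /andP[h _]; lra.
Qed.

Lemma admissible_cat u s : nonneg_word s ->
  admissible b (u ++ s) -> admissible b u && admissible b s.
Proof.
move=> s0; elim: u => //= d u IH /andP[le1 /IH/andP[-> ->]].
rewrite !andbT; apply: le_trans le1.
rewrite -!wval_cons -cat_cons wval_cat.
by rewrite lerDl mulr_ge0 ?wval_ge0// ltW// invbX_gt0.
Qed.

(** A nonzero digit at position [i] alone contributes [b^-i], which is already
    [b^-size] or more. *)
Lemma wval_small w : nonneg_word w ->
  wval b w < b ^- size w -> w = nseq (size w) 0.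
Proof.
elim: w => //= d w IH /andP[d0 w0].
rewrite invbXS ltr_pM2r ?invr_gt0 ?base_gt0// => lt.
have := invbX_le1 (size w); have := wval_ge0 w0 => v0 le1.
have d_lt1 : d%:~R < 1 :> R by lra.
have dE : d = 0.
  by apply/eqP; rewrite eq_le d0 andbT -ltzD1 add0r -(@ltrz1 R).
by rewrite dE in lt *; rewrite -IH//; lra.
Qed.

Lemma wval_cons_lt d e u s n y : d < e ->
  y <= wval b (d :: u) -> wval b (e :: s) < y + b ^- n.+1 ->
  (e - d)%:~R + wval b s - wval b u < b ^- n.
Proof.
move=> de h1 h2.
have : wval b (e :: s) - wval b (d :: u) < b ^- n.+1 by lra.
rewrite invbXS /= -mulrBl ltr_pM2r ?invr_gt0 ?base_gt0// intrD rmorphN /=.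
by lra.
Qed.

(** Two words with first digits [d < e] can only be close if the tail of the
    smaller one nearly reaches the value 1 and compensates the carry.  As that
    tail is at most 1, the gap [e - d] is 1 and the tail of the larger word has
    value less than [b^-n], hence is null. *)
Lemma window_first_digits d e u s n y : d < e ->
  admissible b u -> nonneg_word s -> size s = n ->
  y <= wval b (d :: u) -> wval b (e :: s) < y + b ^- n.+1 ->
  e = d + 1 /\ s = nseq n 0.
Proof.
move=> de ua s0 <- h1 h2; have := wval_cons_lt de h1 h2.
have := wval_le1 ua; have := wval_ge0 s0; have := invbX_le1 (size s).
move=> le1 v0 u1 lt.
have ed1 : e = d + 1.
  apply/eqP; rewrite eq_le; apply/andP; split; last by rewrite -lezD1 in de.
  rewrite leNgt; apply/negP => ed2.
  have : 2 <= (e - d)%:~R :> R by rewrite (ler_int R 2); lia.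
  by lra.
split => //; apply: wval_small => //; move: lt.
by rewrite ed1 [d + 1]addrC addrK; lra.
Qed.

Definition windowed n y w :=
  [&& admissible b w, y <= wval b w & wval b w < y + b ^- n].

Variable A : seq int.
Hypotheses (A_uniq : uniq A) (A_ge0 : nonneg_word A).

Lemma words_nonneg n w : w \in words A n -> nonneg_word w.
Proof.
rewrite mem_words => /andP[_ /allP wA]; apply/allP => d /wA.
exact: (allP A_ge0).
Qed.

(** By induction on the length.  Words of the window with a common first digit
    are counted by the induction hypothesis; at most two first digits occur,
    and the larger one is then carried by a single word. *)
Lemma count_windowed n y : (count (windowed n y) (words A n) <= n.+1)%N.
Proof.
elim: n y => [|n IH] y; first by rewrite (leq_trans (count_size _ _)).
rewrite -size_filter; set L := [seq w <- _ | _].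
have L_uniq : uniq L by rewrite filter_uniq// uniq_words.
have LP w : w \in L -> exists d u, [/\ w = d :: u, u \in words A n,
    windowed n (b * y - d%:~R) u & windowed n.+1 y (d :: u)].
  rewrite mem_filter => /andP[ww /allpairsP[[d u] /= [_ uA wE]]].
  exists d, u; rewrite -wE; split => //; move: ww; rewrite wE.
  rewrite /windowed /= => /and3P[/andP[_ ->]] /=.
  rewrite ler_pdivlMr ?base_gt0// invbXS => h1.
  rewrite ltr_pdivrMr ?base_gt0// mulrDl mulfVK ?gt_eqF ?base_gt0// => h2.
  by apply/andP; split; lra.
pose M d := [seq d :: u | u <- words A n & windowed n (b * y - d%:~R) u].
have sizeM d : (size (M d) <= n.+1)%N by rewrite size_map size_filter.
have memM d u : u \in words A n -> windowed n (b * y - d%:~R) u ->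
    d :: u \in M d.
  by move=> uA uw; apply: map_f; rewrite mem_filter uw.
have [/hasP[w wL /hasP[w' w'L]]|noasc] :=
    boolP (has (fun w => has (fun w' => head 0 w < head 0 w') L) L); last first.
  have [L0|] := boolP (nilp L); first by rewrite (nilP L0).
  rewrite /nilp -lt0n -has_predT => /hasP[w0 w0L _].
  have [d [u [w0E _ _ _]]] := LP _ w0L.
  apply: leq_trans (leqW (sizeM d)); apply: uniq_leq_size => // w wL.
  have [e [s [wE sA sw _]]] := LP _ wL.
  have -> : d = e; last by rewrite wE memM.
  apply/eqP; rewrite eq_le !leNgt; apply/andP; split.
    apply: contra noasc => lt; apply/hasP; exists w => //.
    by apply/hasP; exists w0; rewrite // wE w0E.
  apply: contra noasc => lt; apply/hasP; exists w0 => //.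
  by apply/hasP; exists w; rewrite // wE w0E.
have [d [u [wE uA uw duw]]] := LP _ wL.
have [e [s [w'E sA sw esw]]] := LP _ w'L.
rewrite wE w'E /= => de.
(* Comparing with d :: u or with e :: s leaves no other first digit, and the
   larger of the two digits forces a null tail. *)
have larger c t c' t' : c :: t \in L -> c' :: t' \in L -> c < c' ->
    c' = c + 1 /\ t' = nseq n 0.
  move=> /LP[_ [_ [[<- <-]]]] tA /and3P[ta _ _] /and3P[_ h1 _].
  move=> /LP[_ [_ [[<- <-]]]] t'A _ /and3P[_ _ h2] cc'.
  apply: window_first_digits h1 h2 => //; first exact: words_nonneg t'A.
  by move: t'A; rewrite mem_words => /andP[/eqP].
rewrite wE in wL; rewrite w'E in w'L.
have [eE _] := larger _ _ _ _ wL w'L de.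
suff LM : {subset L <= (e :: nseq n 0) :: M d}.
  by rewrite (leq_trans (uniq_leq_size L_uniq LM))//= ltnS.
move=> v vL; have [c [t [vE tA tw _]]] := LP _ vL; rewrite vE in vL *.
have [cd|dc|cdE] := ltgtP c d; last by rewrite inE -cdE memM ?orbT.
  have [+ _] := larger _ _ _ _ vL w'L (lt_trans cd de).
  by move: cd eE; clear; lia.
have [cE ->] := larger _ _ _ _ wL vL dc.
by rewrite cE eE inE eqxx.
Qed.

(** The cylinders of full words of length [n] are intervals of length [b^-n]
    without common interior points. *)
Lemma full_separated w w' : size w = size w' ->
  nonneg_word w -> nonneg_word w' -> full b w -> full b w' ->
  wval b w <= wval b w' -> w != w' -> wval b w + b ^- size w <= wval b w'.
Proof.
elim: w w' => [|d u IH] [|e s] //= [us] /andP[d0 u0] /andP[e0 s0].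
move=> /andP[_ fu] /andP[_ fs].
have bV0 : 0 < b^-1 by rewrite invr_gt0 base_gt0.
rewrite invbXS -mulrDl !ler_pM2r//.
have [de|ed|<-] := ltgtP d e.
- move=> _ _; have := full_wval fu; have := wval_ge0 s0.
  have : d%:~R + 1 <= e%:~R :> R by rewrite -(intrD _ d 1) ler_int lezD1.
  by lra.
- have := full_wval fs; have := wval_ge0 u0; have := invbX_gt0 (size s).
  have : e%:~R + 1 <= d%:~R :> R by rewrite -(intrD _ e 1) ler_int lezD1.
  by lra.
rewrite lerD2l eqseq_cons eqxx /= => uv us'.
by have := IH s us u0 s0 fu fs uv us'; lra.
Qed.

(** Followed by an expansion close enough to 1, a critical word would have value
    1 or more: this is the obstruction to fullness. *)
Definition critical w := admissible b w && (1 - b ^- size w <= wval b w).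

(** The suffix [s] is the longest critical one.  Prepending a digit [d] keeps the
    prefix full: if [d :: u] had value at least [1 - b^-(size u + 1)], then the
    whole word [d :: u ++ s] would be critical, since [s] is. *)
Lemma admissible_split w : nonneg_word w -> admissible b w ->
  exists u s, [/\ w = u ++ s, full b u & critical s].
Proof.
elim: w => [|d w IH] w0 wa.
  by exists [::], [::]; rewrite /critical /= expr0 invr1 subrr lexx.
have [wc|wnc] := leP (1 - b ^- size (d :: w)) (wval b (d :: w)).
  by exists [::], (d :: w); rewrite /critical wa wc.
have [u [s [wE fu cs]]] : exists u s, [/\ w = u ++ s, full b u & critical s].
  by apply: IH; [case/andP: w0|case/andP: wa].
exists (d :: u), s; split => //; first by rewrite wE.
rewrite /= fu andbT -wval_cons -[(size u).+1]/(size (d :: u)).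
move: wnc; rewrite wE -cat_cons wval_cat size_cat exprD invfM.
have /andP[_ sc] := cs.
have := ler_wpM2l (ltW (invbX_gt0 (size (d :: u)))) sc.
by rewrite mulrBr mulr1; lra.
Qed.

(** The closed interval [[1 - b^-n, 1]] needs two half-open windows. *)
Lemma count_critical n : (count critical (words A n) <= n.+1.*2)%N.
Proof.
have := leq_add (count_windowed n (1 - b ^- n)) (count_windowed n 1).
rewrite addnn; apply: leq_trans; rewrite -count_predUI.
apply: leq_trans (leq_addr _ _).
rewrite -!size_filter; apply: uniq_leq_size; first by rewrite filter_uniq// uniq_words.
move=> w; rewrite !mem_filter => /andP[/andP[wa wc] wA]; rewrite wA andbT /=.
move: wA wc; rewrite mem_words => /andP[/eqP -> _] wc.
rewrite /windowed wa wc /= subrK; have := wval_le1 wa.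
rewrite le_eqVlt => /orP[/eqP -> | ->]//.
by rewrite lexx ltrDl invbX_gt0 orbT.
Qed.

Lemma count_admissible_le_sum n : (count (admissible b) (words A n) <=
  \sum_(0 <= k < n.+1)
    count (full b) (words A k) * count critical (words A (n - k)))%N.
Proof.
pose S k := [seq u ++ s | u <- [seq u <- words A k | full b u],
                          s <- [seq s <- words A (n - k) | critical s]].
have -> : (\sum_(0 <= k < n.+1) count (full b) (words A k) *
    count critical (words A (n - k)) = size (flatten [seq S k | k <- iota 0 n.+1]))%N.
  rewrite size_flatten /shape -map_comp sumnE big_map /index_iota subn0.
  by apply: eq_bigr => k _; rewrite /= size_allpairs !size_filter.
rewrite -size_filter; apply: uniq_leq_size; first by rewrite filter_uniq// uniq_words.
move=> w; rewrite mem_filter => /andP[wa wA].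
have [u [s [wE fu cs]]] := admissible_split (words_nonneg wA) wa.
move: wA; rewrite mem_words wE size_cat all_cat => /andP[/eqP nE /andP[uA sA]].
apply/flatten_mapP; exists (size u); first by rewrite mem_iota /= add0n ltnS -nE leq_addr.
apply/(@allpairsP _ _ _ cat); exists (u, s); rewrite !mem_filter !mem_words fu cs uA sA eqxx /=.
by rewrite -nE addKn eqxx.
Qed.

Lemma count_admissible_le n (c : R) : 1 <= c ->
  (forall k, (count (full b) (words A k))%:R <= c ^+ k) ->
  (count (admissible b) (words A n))%:R <= 2 * n.+1%:R ^+ 2 * c ^+ n.
Proof.
move=> c1 Fc; apply: (@le_trans _ _ (\sum_(0 <= k < n.+1) c ^+ n * n.+1.*2%:R)).
  have := count_admissible_le_sum n; rewrite -(ler_nat R) => /le_trans; apply.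
  rewrite natr_sum; apply: ler_sum_nat => k /andP[_ kn]; rewrite natrM.
  apply: ler_pM => //; first by rewrite (le_trans (Fc k))// ler_weXn2l.
  by rewrite ler_nat (leq_trans (count_critical _))// leq_double ltnS leq_subr.
rewrite sumr_const_nat subn0 -mul2n natrM -[X in X <= _]mulr_natl.
by rewrite le_eqVlt; apply/orP; left; apply/eqP; ring.
Qed.

Lemma count_admissibleD m n : (count (admissible b) (words A (m + n)) <=
  count (admissible b) (words A m) * count (admissible b) (words A n))%N.
Proof.
rewrite -!size_filter -(size_allpairs cat).
apply: uniq_leq_size; first by rewrite filter_uniq// uniq_words.
move=> w; rewrite mem_filter => /andP[wa wA].
have w0 := words_nonneg wA.
move: wA; rewrite mem_words => /andP[/eqP ws wA].
apply/allpairsP; exists (take m w, drop m w) => /=.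
rewrite !mem_filter !mem_words cat_take_drop.
move: wa w0 wA; rewrite -{1 2 3}(cat_take_drop m w) /nonneg_word !all_cat.
move=> wa /andP[_ w0] /andP[-> ->].
have /andP[-> ->] := admissible_cat w0 wa.
by rewrite size_drop size_takel ws ?leq_addr// addKn !eqxx.
Qed.

Lemma count_admissibleM n k : (count (admissible b) (words A (k * n)) <=
  count (admissible b) (words A n) ^ k)%N.
Proof.
elim: k => // k IH; rewrite mulSn expnS.
by apply: leq_trans (count_admissibleD _ _) _; rewrite leq_mul2l IH orbT.
Qed.

End WordValues.

(** * Hausdorff measures *)

Section HausdorffMeasure.
Variable R : realType.
Implicit Types (A B : set R) (s r d : R).

Lemma dist_le_diameter A x y : A x -> A y -> (`|x - y|%:E <= diameter A)%E.
Proof. by move=> Ax Ay; apply: ereal_sup_ubound; exists (x, y). Qed.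

Lemma diameter_ge0 A : A !=set0 -> (0 <= diameter A)%E.
Proof.
by move=> [x Ax]; rewrite (le_trans _ (dist_le_diameter Ax Ax))// lee_fin.
Qed.

Lemma diameter_set0_le d : (diameter (@set0 R) <= d%:E)%E.
Proof. by apply: ge_ereal_sup => ? [p []]. Qed.

Lemma diameter_itv_le (a r : R) : (diameter `[a, (a + r)%R]%classic <= r%:E)%E.
Proof.
apply: ge_ereal_sup => _ [[x y] [/= + +] <-]; rewrite lee_fin !in_itv /=.
move=> /andP[ax xa] /andP[ay ya].
by rewrite ler_norml; apply/andP; split; lra.
Qed.

Lemma poweR_diameter_le A r s : 0 <= s -> A !=set0 ->
  (diameter A <= r%:E)%E -> (diameter A `^ s <= (r `^ s)%:E)%E.
Proof.
move=> s0 /diameter_ge0; case: (diameter A) => [x| |]//=.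
rewrite !lee_fin => x0 xr; apply: ge0_ler_powR => //.
by rewrite nnegrE (le_trans x0).
Qed.

Lemma hausdorff_content_ge0 s d A : (0 <= hausdorff_content s d A)%E.
Proof.
apply: le_ereal_inf_tmp => _ [U _ <-]; apply: nneseries_ge0 => i _ _.
exact: poweR_ge0.
Qed.

Lemma hausdorff_content_cover s d A (L : seq R) r :
  0 <= s -> 0 <= r <= d -> A `<=` [set x | exists2 a, a \in L & a <= x <= a + r] ->
  (hausdorff_content s d A <= ((size L)%:R * r `^ s)%:E)%E.
Proof.
move=> s0 /andP[r0 rd] AL.
pose U i := if (i < size L)%N then `[nth 0 L i, nth 0 L i + r]%classic else set0.
have Ur i : (diameter (U i) <= r%:E)%E.
  by rewrite /U; case: ifP => _; [exact: diameter_itv_le|exact: diameter_set0_le].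
apply: (@le_trans _ _ (\sum_(0 <= i <oo | U i != set0) diameter (U i) `^ s)%E).
  apply: ereal_inf_lbound; exists U => //; split; last first.
    by move=> i; rewrite (le_trans (Ur i))// lee_fin.
  move=> x /AL[a aL xa]; exists (index a L) => //.
  by rewrite /U index_mem aL nth_index//= in_itv.
rewrite (nneseries_split_cond 0 (size L)); last by move=> *; exact: poweR_ge0.
rewrite add0n eseries0 ?adde0; last first.
  by move=> i iL; rewrite /U ltnNge iL eqxx.
rewrite big_mkcond /= (le_trans (y := (\sum_(0 <= i < size L) (r `^ s)%:E)%E))//.
  apply: lee_sum => i _; case: ifPn => [/set0P Ui|_].
    exact: poweR_diameter_le.
  by rewrite lee_fin powR_ge0.
by rewrite sumEFin lee_fin sumr_const_nat subn0 mulr_natl.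
Qed.

Lemma hausdorff_measure_eq0 s A : 0 <= s ->
  (forall d e : R, 0 < d -> 0 < e -> exists (L : seq R) r,
    [/\ 0 <= r <= d, (size L)%:R * r `^ s <= e &
        A `<=` [set x | exists2 a, a \in L & a <= x <= a + r]]) ->
  hausdorff_measure s A = 0%E.
Proof.
move=> s0 cov; apply/eqP; rewrite eq_le; apply/andP; split; last first.
  apply: le_trans (hausdorff_content_ge0 s 1 A) _.
  by apply: ereal_sup_ubound; exists 1 => //=.
apply: ge_ereal_sup => _ [d /= d0 <-]; apply/lee_addgt0Pr => e e0.
have [L [r [rd Le AL]]] := cov _ _ d0 e0; rewrite add0e.
by apply: le_trans (hausdorff_content_cover s0 rd AL) _; rewrite lee_fin.
Qed.

(** A form of the mass distribution principle.  If [g] maps [[0, 1)] into [A] and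
    its inverse is Hoelder of exponent [s], a cover of [A] pulls back to a cover
    of [[0, 1)] by sets contained in intervals of length [2 C diam^s], and the
    Lebesgue measure of [[0, 1)] bounds the sum of these lengths from below. *)
Lemma hausdorff_measure_neq0 s A (g : R -> R) C : 0 <= s -> 0 < C ->
  (forall z, 0 <= z < 1 -> A (g z)) ->
  (forall z z', 0 <= z < 1 -> 0 <= z' < 1 -> `|z - z'| <= C * `|g z - g z'| `^ s) ->
  hausdorff_measure s A != 0%E.
Proof.
move=> s0 C0 gA gC.
suff le : ((2 * C)^-1%:E <= hausdorff_content s 1 A)%E.
  rewrite gt_eqF// (@lt_le_trans _ _ (2 * C)^-1%:E)//.
    by rewrite lte_fin invr_gt0 mulr_gt0.
  apply: le_trans le _.
  by apply: ereal_sup_ubound; exists 1 => //=.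
apply: le_ereal_inf_tmp => _ [U [/= AU U1] <-].
pose V i : set R := [set z | 0 <= z < 1 /\ U i (g z)].
have UV i : V i !=set0 -> U i !=set0 by move=> [z [_ Uz]]; exists (g z).
pose rad i := C * fine (diameter (U i)) `^ s.
have Ufin i : U i !=set0 -> (fine (diameter (U i)))%:E = diameter (U i).
  move=> /diameter_ge0 d0; have := U1 i; move: d0.
  by case: (diameter (U i)).
(* A nonempty preimage is centred at one of its own points. *)
pose ctr i := xget 0 (V i).
pose W i : set R := if U i != set0 then `[ctr i - rad i, ctr i + rad i]%classic
  else set0.
have VW i : V i `<=` W i.
  move=> z Vz; have Vn : V i !=set0 by exists z.
  have Un := UV _ Vn; rewrite /W ifT; last exact/set0P.
  have [z01 Uz] := Vz; have /(xgetPex 0)[c01 Uc] := Vn.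
  rewrite -/(ctr i) in c01 Uc.
  have : `|z - ctr i| <= rad i.
    apply: le_trans (gC _ _ z01 c01) _; rewrite /rad ler_pM2l//.
    apply: ge0_ler_powR; rewrite ?nnegrE ?fine_ge0 ?diameter_ge0//.
    by rewrite -lee_fin Ufin//; exact: dist_le_diameter.
  by rewrite /= in_itv /= ler_norml => /andP[]; lra.
have Wm i : measurable (W i) by rewrite /W; case: ifP.
have : (lebesgue_measure (`[0%R, 1%R[%classic : set R) <=
    \sum_(0 <= i <oo) lebesgue_measure (W i))%E.
  apply: measure_sigma_subadditive => //; move=> z /=; rewrite in_itv /= => z01.
  have [i _ Uz] := AU _ (gA _ z01); exists i => //; apply: VW.
  by split.
rewrite lebesgue_measure_itv /= lte_fin ltr01 sube0.
have Wle i : (lebesgue_measure (W i) <=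
    if U i != set0 then ((2 * C)%:E * diameter (U i) `^ s)%E else 0)%E.
  rewrite /W; case: ifPn => [/set0P Un|_]; last by rewrite measure0.
  rewrite lebesgue_measure_itv /=.
  have rad0 : 0 <= rad i by rewrite mulr_ge0 ?powR_ge0// ltW.
  have -> : ((2 * C)%:E * diameter (U i) `^ s)%E = (2 * rad i)%:E.
    by rewrite -Ufin// poweR_EFin -EFinM /rad mulrA.
  case: ifP => _; last by rewrite lee_fin mulr_ge0.
  by rewrite -EFinB lee_fin; lra.
move=> le1; have := le_trans le1 (lee_nneseries (fun _ _ _ => measure_ge0 _ _)
  (fun i _ => Wle i)).
rewrite -(eseries_mkcond (P := fun i => U i != set0)).
rewrite nneseriesZl; last by move=> *; exact: poweR_ge0.
by rewrite -lee_pdivrMl ?mulr_gt0// mule1.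
Qed.

Lemma hausdorff_dim_ge0 A : (0 <= hausdorff_dim A)%E.
Proof. by apply: le_ereal_inf_tmp => _ [s [s0 _] <-]; rewrite lee_fin. Qed.

Lemma hausdorff_dim_le s A : 0 <= s -> hausdorff_measure s A = 0%E ->
  (hausdorff_dim A <= s%:E)%E.
Proof. by move=> s0 As; apply: ereal_inf_lbound; exists s. Qed.

Lemma hausdorff_dim_ge s A :
  (forall t, 0 <= t < s -> hausdorff_measure t A != 0%E) ->
  (s%:E <= hausdorff_dim A)%E.
Proof.
move=> As; apply: le_ereal_inf_tmp => _ [t [t0 At] <-]; rewrite lee_fin leNgt.
by apply/negP => ts; have := As t; rewrite t0 ts At eqxx => /(_ isT).
Qed.
End HausdorffMeasure.

(** * Real powers *)

Section PowR.
Variable R : realType.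
Implicit Types a s : R.

Lemma powRX a s n : 0 <= a -> (a ^+ n) `^ s = (a `^ s) ^+ n.
Proof.
move=> a0; elim: n => [|n IH]; first by rewrite !expr0 powR1.
by rewrite !exprS powRM ?exprn_ge0// IH.
Qed.

Lemma powRV a s : 0 < a -> (a^-1) `^ s = (a `^ s)^-1.
Proof. by move=> a0; rewrite -!powR_inv1 ?powR_ge0 ?ltW// powRAC. Qed.
End PowR.

(** * Greedy expansions *)

Section Expansions.
Variables (R : realType) (b : R).
Hypothesis b_gt1 : 1 < b.
Implicit Types x y : R.

Lemma beta_map_itv x : 0 <= beta_map b x < 1.
Proof. by have := floor_itv (b * x); rewrite /beta_map intrD => /andP[]; lra. Qed.

Lemma beta_mapE x d y : b * x = d%:~R + y -> 0 <= y < 1 ->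
  Num.floor (b * x) = d /\ beta_map b x = y.
Proof.
move=> bx /andP[y0 y1]; rewrite /beta_map.
have -> : Num.floor (b * x) = d.
  by apply: floor_def; rewrite bx intrD; apply/andP; split; lra.
by split=> //; lra.
Qed.

Lemma beta_digit_iter x n k : (0 < k)%N ->
  beta_digit b (iter n (beta_map b) x) k = beta_digit b x (n + k).
Proof. by case: k => // k _; rewrite /beta_digit addnS /= -iterD addnC. Qed.

Fixpoint greedy x n : seq int :=
  if n is n'.+1 then Num.floor (b * x) :: greedy (beta_map b x) n' else [::].

Lemma greedy_bounds x n : 0 <= x < 1 ->
  wval b (greedy x n) <= x <= wval b (greedy x n) + b ^- n.
Proof.
elim: n x => [|n IH] x x01; first by case/andP: x01 => x0 x1; rewrite expr0 invr1 /=; lra.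
have /andP[h1 h2] := IH _ (beta_map_itv x); have b0 := base_gt0 b_gt1.
rewrite wval_cons invbXS// -mulrDl ler_pdivrMr// ler_pdivlMr//.
have bm : beta_map b x = b * x - (Num.floor (b * x))%:~R by [].
by apply/andP; split; lra.
Qed.

Lemma greedy_admissible x n : 0 <= x < 1 -> admissible b (greedy x n).
Proof.
elim: n x => //= n IH x x01; rewrite IH ?beta_map_itv// andbT.
have /andP[le_x _] := greedy_bounds n.+1 x01.
by have /andP[_ /ltW] := x01; apply: le_trans.
Qed.

(** The points whose expansion uses only digits of [A]; its closure is the Cantor
    set under study. *)
Definition digit_set (A : seq int) : set R :=
  [set x | 0 <= x < 1 /\ forall k, (0 < k)%N -> beta_digit b x k \in A].

Lemma greedy_words A x n : digit_set A x -> greedy x n \in words A n.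
Proof.
elim: n x => [|n IH] x [x01 xA]; first by rewrite inE.
apply: allpairs_f; first exact: (xA 1).
apply: IH; split; first exact: beta_map_itv.
by move=> k k0; have := beta_digit_iter x 1 k0; rewrite /= => ->; apply: xA.
Qed.

(** Fullness keeps the orbit of [x] inside [[0, 1)] while the digits of [w] are
    read, so the greedy algorithm reads exactly [w] and then continues from
    [y]. *)
Lemma full_digits w y : nonneg_word w -> full b w -> 0 <= y < 1 ->
  let x := wval b w + b ^- size w * y in
  [/\ 0 <= x < 1, iter (size w) (beta_map b) x = y &
      forall k, (0 < k <= size w)%N -> beta_digit b x k \in w].
Proof.
elim: w => [|d w IH] w0 fw y01 x.
  by rewrite /x /= expr0 invr1 mul1r add0r; split=> // -[].
have [||x'01 iterx' dig] := IH _ _ y01; first by case/andP: w0.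
  by case/andP: fw.
set x' := wval b w + b ^- size w * y in x'01 iterx' dig.
have b0 := base_gt0 b_gt1.
have bx : b * x = d%:~R + x'.
  rewrite /x /x' wval_cons invbXS//; field.
  by rewrite !gt_eqF ?exprn_gt0.
have [fl bm] := beta_mapE bx x'01.
split.
- apply/andP; split.
    rewrite -(pmulr_rge0 _ b0) bx; have /andP[d0 _] := w0.
    by rewrite addr_ge0 ?ler0z//; case/andP: x'01.
  have := full_wval fw; have /andP[+ _] := fw.
  move=> lt1 _; apply: le_lt_trans lt1; rewrite lerD2l ler_piMr ?ltW ?invbX_gt0//.
  by case/andP: y01.
- by rewrite iterSr bm.
case=> // -[|k]; first by rewrite /beta_digit /= fl mem_head.
rewrite /= ltnS => kw; rewrite -[k.+2]/(1 + k.+1)%N -beta_digit_iter//= bm.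
by rewrite inE dig ?orbT.
Qed.

End Expansions.

(** * Upper bound for the dimension *)

Section UpperBound.
Variables (R : realType) (b : R) (A : seq int).
Hypotheses (b_gt1 : 1 < b) (A_uniq : uniq A) (A_ge0 : nonneg_word A).

(** A finite union of closed intervals is closed. *)
Lemma closure_cover (X : set R) (L : seq R) (r : R) :
  X `<=` [set x | exists2 a, a \in L & a <= x <= a + r] ->
  closure X `<=` [set x | exists2 a, a \in L & a <= x <= a + r].
Proof.
set S := [set x | _] => XS.
suff /closure_id -> : closed S by exact: closureS.
have -> : S = \bigcup_(a in [set` L]) `[a, a + r]%classic.
  by apply/seteqP; split=> x [a aL]; rewrite /= ?in_itv /= => h; exists a;
    rewrite //= in_itv.
by apply: closed_bigcup => [|a _]; [exact: finite_seq|exact: interval_closed].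
Qed.

(** The Cantor set is covered by [N_(k n) <= N_n ^ k] intervals of length
    [b^-(k n)], whose s-sum [(N_n / b^(s n)) ^ k] tends to 0 with [k]. *)
Lemma hausdorff_dim_le_count n s : 0 <= s ->
  (count (admissible b) (words A n))%:R < (b `^ s) ^+ n ->
  (hausdorff_dim (closure (digit_set b A)) <= s%:E)%E.
Proof.
move=> s0 Nlt; apply: hausdorff_dim_le => //.
have b0 := base_gt0 b_gt1; have c0 : 0 < b `^ s by rewrite powR_gt0.
apply: hausdorff_measure_eq0 => // d e d0 e0.
pose N : R := (count (admissible b) (words A n))%:R.
pose q := N / (b `^ s) ^+ n.
have q0 : 0 <= q by rewrite divr_ge0 ?exprn_ge0// ltW.
have q1 : `|q| < 1.
  by rewrite ger0_norm// ltr_pdivrMr ?exprn_gt0// mul1r.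
have [n0|n_gt0] := posnP n.
  by move: Nlt; rewrite n0 expr0 /= ltxx.
have h1 : `|b ^- n| < 1.
  rewrite gtr0_norm ?invbX_gt0// invf_lt1 ?exprn_gt0//.
  by rewrite exprn_egt1// -lt0n.
have [k [kd ke]] : exists k, (b ^- n) ^+ k <= d /\ q ^+ k <= e.
  near \oo => k; exists k; split; apply: ltW; near: k.
    exact: (cvgr_lt 0 (cvg_expr h1)).
  exact: (cvgr_lt 0 (cvg_expr q1)).
exists [seq wval b w | w <- words A (k * n) & admissible b w], (b ^- (k * n)).
have bknE : b ^- (k * n) = (b ^- n) ^+ k by rewrite -exprVn mulnC exprM exprVn.
split.
- by rewrite ltW ?invbX_gt0//= bknE.
- apply: le_trans ke; rewrite size_map size_filter.
  have -> : (b ^- (k * n)) `^ s = ((b `^ s) ^- n) ^+ k.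
    by rewrite bknE powRX ?ltW ?invbX_gt0// powRV ?exprn_gt0// powRX// ltW.
  rewrite /q exprMn ler_pM2r ?exprn_gt0 ?invr_gt0 ?exprn_gt0//.
  by rewrite /N -natrX ler_nat count_admissibleM.
apply: closure_cover => x Xx; have [x01 _] := Xx.
exists (wval b (greedy b x (k * n))); last exact: greedy_bounds.
by apply: map_f; rewrite mem_filter greedy_admissible//= greedy_words.
Unshelve. all: by end_near. Qed.

End UpperBound.

(** * Coding of a self-similar set *)

(** The [q] similarities [y |-> v i + h * y] map [[0, 1]] to intervals of length
    [h] with disjoint interiors, from left to right.  A point [z] of [[0, 1)] is
    sent to the point of the attractor whose address is the base-[q] expansion
    of [z]. *)
Section SelfSimilarCoding.
Variables (R : realType) (q : nat) (h : R) (v : nat -> R).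
Hypotheses (q_gt1 : (1 < q)%N) (h_itv : 0 < h < 1).
Hypothesis v_itv : forall i, (i < q)%N -> 0 <= v i <= 1 - h.
Hypothesis v_sep : forall i j, (i < j < q)%N -> v i + h <= v j.
Implicit Types y z : R.

Definition tail_pt z : R := beta_map q%:R z.
Definition letter z : nat := `|Num.floor (q%:R * z)|%N.

Lemma alphabet_gt1 : 1 < q%:R :> R. Proof. by rewrite ltr1n. Qed.

Lemma tail_pt_itv z : 0 <= tail_pt z < 1.
Proof. exact: beta_map_itv. Qed.

Lemma letterE z : 0 <= z < 1 -> q%:R * z = (letter z)%:R + tail_pt z.
Proof.
move=> /andP[z0 _]; rewrite /tail_pt /beta_map /letter natr_absz ger0_norm.
  by rewrite addrC subrK.
by rewrite floor_ge0 mulr_ge0.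
Qed.

Lemma letter_lt z : 0 <= z < 1 -> (letter z < q)%N.
Proof.
move=> z01; rewrite -(ltr_nat R); have := letterE z01.
have /andP[_ z1] := z01; have /andP[+ _] := tail_pt_itv z.
have : q%:R * z < q%:R by rewrite gtr_pMr// (lt_trans _ alphabet_gt1).
by lra.
Qed.

(** The image of 0 under the first [k] similarities of the address of [z]: an
    increasing sequence. *)
Fixpoint approx k z : R :=
  if k is k'.+1 then v (letter z) + h * approx k' (tail_pt z) else 0.

Lemma branch_itv i y : (i < q)%N -> 0 <= y <= 1 -> 0 <= v i + h * y <= 1.
Proof.
move=> iq /andP[y0 y1]; have /andP[v0 v1] := v_itv iq.
have /andP[h0 h1] := h_itv; have := ler_piMr (ltW h0) y1.
have := mulr_ge0 (ltW h0) y0; by lra.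
Qed.

Lemma approx_itv k z : 0 <= z < 1 -> 0 <= approx k z <= 1.
Proof.
elim: k z => [|k IH] z z01 /=; first by rewrite lexx ler01.
by rewrite branch_itv ?letter_lt ?IH ?tail_pt_itv.
Qed.

Lemma approx_leS k z : 0 <= z < 1 -> approx k z <= approx k.+1 z.
Proof.
elim: k z => [|k IH] z z01; first by have /andP[] := approx_itv 1 z01.
have /andP[h0 _] := h_itv.
by rewrite /= lerD2l ler_pM2l//; apply: IH; exact: tail_pt_itv.
Qed.

Definition coding z : R := limn (approx^~ z).

Lemma cvg_approx z : 0 <= z < 1 -> approx^~ z @ \oo --> coding z.
Proof.
move=> z01; apply: nondecreasing_is_cvgn.
  by apply/nondecreasing_seqP => k; exact: approx_leS.
by exists 1 => _ [k _ <-]; have /andP[] := approx_itv k z01.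
Qed.

Lemma coding_itv z : 0 <= z < 1 -> 0 <= coding z <= 1.
Proof.
move=> z01; have /cvgP cv := cvg_approx z01; apply/andP; split.
  by apply: limr_ge => //; near=> k; have /andP[] := approx_itv k z01.
by apply: limr_le => //; near=> k; have /andP[] := approx_itv k z01.
Unshelve. all: by end_near. Qed.

Lemma codingE z : 0 <= z < 1 -> coding z = v (letter z) + h * coding (tail_pt z).
Proof.
move=> z01; have := cvg_approx z01; rewrite -(cvg_shiftS (approx^~ z)) /= => cv.
apply: (cvg_unique _ cv) => //.
apply: cvgD; first exact: cvg_cst.
by apply: cvgM; [exact: cvg_cst|apply: cvg_approx; exact: tail_pt_itv].
Qed.

(** From [q^-k] on, the image lies to the right of the first cell of order [k],
    which has length [h^k] and starts at a nonnegative point. *)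
Lemma coding_ge k z : 0 <= z < 1 -> q%:R ^- k <= z -> h ^+ k <= coding z.
Proof.
have q1 := alphabet_gt1; have /andP[h0 h1] := h_itv.
elim: k z => [|k IH] z z01; first by rewrite expr0 invr1; case/andP: z01; lra.
have /andP[v0 _] := v_itv (letter_lt z01).
have /andP[g0 _] := coding_itv (tail_pt_itv z).
have hg0 := mulr_ge0 (ltW h0) g0.
rewrite invbXS// ler_pdivrMr ?base_gt0// mulrC letterE// codingE// exprS => zk.
have [e0|e0] := posnP (letter z).
  rewrite e0 in v0 *.
  have : h * h ^+ k <= h * coding (tail_pt z).
    by rewrite ler_pM2l//; apply: IH; [exact: tail_pt_itv|rewrite e0 in zk; lra].
  by lra.
have /andP[v00 _] : 0 <= v 0 <= 1 - h by apply: v_itv; lia.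
have : v 0 + h <= v (letter z) by apply: v_sep; rewrite e0 letter_lt.
have : h * h ^+ k <= h by rewrite ler_piMr ?exprn_ile1// ltW.
by lra.
Qed.

(** The mirror image of [coding_ge].  The hypothesis is strict because [z] ranges
    over [[0, 1)]: it must be void for [k = 0]. *)
Lemma coding_le k z : 0 <= z < 1 -> q%:R ^- k < 1 - z -> h ^+ k <= 1 - coding z.
Proof.
have q1 := alphabet_gt1; have /andP[h0 h1] := h_itv.
elim: k z => [|k IH] z z01; first by rewrite expr0 invr1; case/andP: z01; lra.
have /andP[_ v1] := v_itv (letter_lt z01).
have /andP[_ g1] := coding_itv (tail_pt_itv z).
have hg1 := ler_piMr (ltW h0) g1.
have q0 : 0 < q%:R :> R := base_gt0 q1.
rewrite invbXS// ltr_pdivrMr// mulrC mulrBr mulr1 letterE// codingE// exprS => zk.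
have [eq|eq] := leqP q (letter z).+1.
  have eE : (letter z)%:R = q%:R - 1 :> R.
    have -> : q = (letter z).+1 by apply/eqP; rewrite eqn_leq eq letter_lt.
    by rewrite -natr1 addrK.
  have : h * h ^+ k <= h * (1 - coding (tail_pt z)).
    by rewrite ler_pM2l//; apply: IH; [exact: tail_pt_itv|lra].
  by lra.
have /andP[_ vq1] := v_itv eq.
have : v (letter z) + h <= v (letter z).+1 by apply: v_sep; rewrite ltnSn.
have : h * h ^+ k <= h by rewrite ler_piMr ?exprn_ile1// ltW.
by lra.
Qed.

(** At distance [2 q^-k], two points are separated by a whole cell of order [k],
    whose image has length [h^k].  When the first letters are consecutive, that
    cell lies entirely on one side of the common boundary, and [coding_ge] or
    [coding_le] applies to the tail on that side. *)
Lemma coding_sep k z z' : 0 <= z < 1 -> 0 <= z' < 1 ->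
  2 * q%:R ^- k <= z - z' -> h ^+ k <= coding z - coding z'.
Proof.
have q1 := alphabet_gt1; have /andP[h0 h1] := h_itv.
have q0 : 0 < q%:R :> R := base_gt0 q1.
elim: k z z' => [|k IH] z z' z01 z'01.
  by rewrite expr0 invr1; case/andP: z01; case/andP: z'01; lra.
rewrite invbXS// mulrA ler_pdivrMr// mulrC [_ * q%:R]mulrC mulrBr !letterE// => zk.
have s01 := tail_pt_itv z; have s'01 := tail_pt_itv z'.
have /andP[g0 g1] := coding_itv s01; have /andP[g'0 g'1] := coding_itv s'01.
rewrite (codingE z01) (codingE z'01) exprS.
have hk1 : h * h ^+ k <= h by rewrite ler_piMr ?exprn_ile1// ltW.
have gg : h * (coding (tail_pt z') - coding (tail_pt z)) <= h.
  by apply: ler_piMr; [exact: ltW|lra].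
have k0 := invbX_gt0 q1 k.
have [lt|gt|eE] := ltngtP (letter z) (letter z').
- have : (letter z)%:R + 1 <= (letter z')%:R :> R by rewrite natr1 ler_nat.
  by case/andP: s01 s'01 => _ ? /andP[? _]; lra.
- have [far|near] := leqP (letter z').+2 (letter z).
    have l2 : ((letter z').+1 < q)%N by apply: leq_ltn_trans (letter_lt z01); exact: ltnW.
    have := v_sep (i := letter z') (j := (letter z').+1).
    have := v_sep (i := (letter z').+1) (j := letter z).
    rewrite ltnSn l2 far letter_lt// => /(_ isT) vz /(_ isT) vz'.
    by lra.
  have eE : letter z = (letter z').+1 by apply/eqP; rewrite eqn_leq gt andbT.
  have vS : v (letter z') + h <= v (letter z).
    by apply: v_sep; rewrite gt letter_lt.
  move: zk; rewrite eE -natr1 => zk.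
  have [ge|lt] := leP (q%:R ^- k) (tail_pt z).
    have : h * h ^+ k <= h * coding (tail_pt z) by rewrite ler_pM2l// coding_ge.
    have : h * coding (tail_pt z') <= h by rewrite ler_piMr// ltW.
    by rewrite -eE; lra.
  have : h * h ^+ k <= h * (1 - coding (tail_pt z')).
    by rewrite ler_pM2l// coding_le//; lra.
  have := mulr_ge0 (ltW h0) g0.
  by rewrite -eE; lra.
have : h * h ^+ k <= h * (coding (tail_pt z) - coding (tail_pt z')).
  by rewrite ler_pM2l//; apply: IH => //; move: zk; rewrite eE; lra.
by rewrite eE; lra.
Qed.

(** Compare [z - z'] with the least [k] such that [2 q^-k <= z - z']: minimality
    bounds [z - z'] by [2 q q^-k], and [q^-k] is at most the [s]-th power of
    [h^k], itself a lower bound of the distance of the images. *)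
Lemma coding_holder s z z' : 0 <= s -> 1 <= q%:R * h `^ s ->
  0 <= z < 1 -> 0 <= z' < 1 ->
  `|z - z'| <= (2 * q%:R) * `|coding z - coding z'| `^ s.
Proof.
move=> s0 qh; wlog zz' : z z' / z' < z.
  move=> wl z01 z'01; have [lt|lt|->] := ltgtP z z'.
  - by rewrite distrC [X in _ * X `^ _]distrC wl.
  - exact: wl.
  - by rewrite subrr normr0 mulr_ge0 ?powR_ge0 ?mulr_ge0.
move=> z01 z'01; have q1 := alphabet_gt1; have /andP[h0 h1] := h_itv.
have q0 : 0 < q%:R :> R := base_gt0 q1.
have ex : exists k, 2 * q%:R ^- k <= z - z'.
  have qV : `|q%:R^-1 : R| < 1 by rewrite gtr0_norm ?invr_gt0// invf_lt1.
  have e0 : 0 < (z - z') / 2 by rewrite divr_gt0// subr_gt0.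
  near \oo => k; exists k; rewrite mulrC -ler_pdivlMr// -exprVn ltW//.
  by near: k; exact: (cvgr_lt 0 (cvg_expr qV)).
have := ex_minnP ex; case=> -[|k] hk min_k.
  move: hk; rewrite expr0 invr1; case/andP: z01; case/andP: z'01.
  by lra.
have zlt : z - z' < 2 * q%:R ^- k.
  by rewrite ltNge; apply/negP => /min_k; rewrite ltnn.
have gk := coding_sep z01 z'01 hk.
rewrite ger0_norm ?subr_ge0 ?(ltW zz')//.
rewrite ger0_norm; last by apply: le_trans gk; rewrite exprn_ge0// ltW.
have : (h ^+ k.+1) `^ s <= (coding z - coding z') `^ s.
  by apply: ge0_ler_powR; rewrite ?nnegrE// ?(le_trans _ gk)// exprn_ge0// ltW.
have : q%:R ^- k.+1 <= (h ^+ k.+1) `^ s.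
  rewrite powRX ?(ltW h0)// -div1r ler_pdivrMr ?exprn_gt0// -exprMn mulrC.
  by rewrite exprn_ege1.
move=> a1 a2; apply: (le_trans (ltW zlt)); rewrite -mulrA ler_pM2l//.
apply: (@le_trans _ _ (q%:R * q%:R ^- k.+1)).
  by rewrite invbXS// mulrCA divff ?gt_eqF// mulr1.
by rewrite ler_pM2l// (le_trans a1).
Unshelve. all: by end_near. Qed.

End SelfSimilarCoding.

(** * Lower bound for the dimension *)

Section LowerBound.
Variables (R : realType) (b : R) (A : seq int).
Hypotheses (b_gt1 : 1 < b) (A_uniq : uniq A) (A_ge0 : nonneg_word A).

(** Listed by increasing value, so that the coding below preserves order. *)
Definition full_words n : seq (seq int) :=
  sort (fun u w => wval b u <= wval b w) [seq w <- words A n | full b w].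

Lemma mem_full_words n w : (w \in full_words n) = full b w && (w \in words A n).
Proof. by rewrite mem_sort mem_filter. Qed.

Lemma full_words_sep n i j : (i < j < size (full_words n))%N ->
  wval b (nth [::] (full_words n) i) + b ^- n <=
  wval b (nth [::] (full_words n) j).
Proof.
move=> /andP[ij jG]; have iG := ltn_trans ij jG.
have := mem_nth [::] iG; have := mem_nth [::] jG.
rewrite !mem_full_words => /andP[fj jA] /andP[fi iA].
move: (iA) (jA); rewrite !mem_words => /andP[/eqP si _] /andP[/eqP sj _].
rewrite -[in b ^- n]si; apply: full_separated => //; first by rewrite si sj.
- exact: words_nonneg iA.
- exact: words_nonneg jA.
- pose leT (u w : seq int) := wval b u <= wval b w.
  apply: (@sorted_leq_nth _ leT _ _ [::] (full_words n)) => //.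
  + by move=> ? ? ?; exact: le_trans.
  + by move=> ?; exact: lexx.
  + by apply: sort_sorted => ? ?; exact: le_total.
  + exact: ltnW.
by rewrite nth_uniq// ?sort_uniq ?filter_uniq ?uniq_words// ltn_eqF.
Qed.

(** The similarities are the concatenations [y |-> val w + b^-n y] with the full
    words [w] of length [n].  The points of their attractor have all their digits
    in [A] by [full_digits], and the strict inequality in the definition of full
    words keeps them below 1. *)
Lemma hausdorff_dim_ge_count n s : (0 < n)%N -> 0 <= s ->
  (b `^ s) ^+ n < (count (full b) (words A n))%:R ->
  (s%:E <= hausdorff_dim (closure (digit_set b A)))%E.
Proof.
move=> n0 s0 Fgt; set G := full_words n; pose q := size G.
have qE : q = count (full b) (words A n) by rewrite /q size_sort size_filter.
have b0 := base_gt0 b_gt1.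
have bs1 : 1 <= b `^ s by rewrite -(powRr0 b) ler_powR// ltW.
have q_gt1 : (1 < q)%N.
  by rewrite -(ltr_nat R) qE (le_lt_trans _ Fgt)// exprn_ege1.
pose v i := wval b (nth [::] G i); pose h := b ^- n.
have h_itv : 0 < h < 1.
  rewrite invbX_gt0//= invf_lt1 ?exprn_gt0// exprn_egt1//.
  by rewrite -lt0n.
have GP i : (i < q)%N -> [/\ nonneg_word (nth [::] G i), full b (nth [::] G i),
    size (nth [::] G i) = n & all [in A] (nth [::] G i)].
  move=> iq; have := mem_nth [::] iq; rewrite mem_full_words => /andP[fi iA].
  have w0 := words_nonneg A_ge0 iA.
  by move: iA; rewrite mem_words => /andP[/eqP].
have v_lt i : (i < q)%N -> v i + h < 1.
  move=> /GP[_ + si _]; rewrite /v /h -[in b ^- n]si.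
  move: si; case: (nth _ _ _) => [|d w]; first by move=> n00; rewrite -n00 in n0.
  by move=> _ /andP[].
have v_itv i : (i < q)%N -> 0 <= v i <= 1 - h.
  move=> iq; have [w0 _ _ _] := GP _ iq; rewrite wval_ge0//=.
  by have := v_lt _ iq; lra.
have v_sep i j : (i < j < q)%N -> v i + h <= v j by exact: full_words_sep.
pose g := coding q h v.
have g_lt1 z : 0 <= z < 1 -> 0 <= g z < 1.
  move=> z01; have /andP[-> _] := coding_itv q_gt1 h_itv v_itv z01.
  rewrite /g (codingE q_gt1 h_itv v_itv z01) /=.
  apply: le_lt_trans (v_lt _ (letter_lt q_gt1 z01)); rewrite lerD2l.
  have /andP[h0 _] := h_itv; rewrite ler_piMr ?(ltW h0)//.
  by have /andP[] := coding_itv q_gt1 h_itv v_itv (tail_pt_itv q z).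
have g_digits k z : 0 <= z < 1 -> (0 < k)%N -> beta_digit b (g z) k \in A.
  elim/ltn_ind: k z => k IH z z01 k0.
  have lz := letter_lt q_gt1 z01; have [w0 fw ws wA] := GP _ lz.
  have gz : g z = wval b (nth [::] G (letter q z)) +
      b ^- size (nth [::] G (letter q z)) * g (tail_pt q z).
    by rewrite /g (codingE q_gt1 h_itv v_itv z01) ws.
  have [_ iterg dig] := full_digits b_gt1 w0 fw (g_lt1 _ (tail_pt_itv q z)).
  rewrite -gz ws in iterg dig.
  have [kn|nk] := leqP k n.
    by apply: (allP wA); apply: dig; rewrite k0.
  rewrite -(subnKC (ltnW nk)) -beta_digit_iter ?subn_gt0// iterg.
  by apply: IH; [lia|exact: tail_pt_itv|rewrite subn_gt0].
apply: hausdorff_dim_ge => t /andP[t0 ts].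
apply: (@hausdorff_measure_neq0 _ _ _ g (2 * q%:R)) => //.
- by rewrite mulr_gt0// ltr0n ltnW.
- move=> z z01; apply: subset_closure; split; first exact: g_lt1.
  by move=> k; exact: g_digits.
move=> z z' z01 z'01; apply: coding_holder => //.
rewrite /h powRV ?exprn_gt0// powRX ?(ltW b0)//.
rewrite ler_pdivlMr ?exprn_gt0 ?powR_gt0// mul1r qE; apply: le_trans (ltW Fgt).
by rewrite lerXn2r ?nnegrE ?powR_ge0// ler_powR// ltW.
Qed.

End LowerBound.

(** * Dependence on the base *)

Section Continuity.
Variable R : realType.
Implicit Types (b s : R) (A : seq int).

Lemma wval_continuous w b : b != 0 -> {for b, continuous (fun b => wval b w)}.
Proof.
move=> b0; elim: w => [|d w IH]; first exact: cvg_cst.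
rewrite /continuous_at /=.
apply: cvgM; last by apply: cvgV.
by apply: cvgD => //; exact: cvg_cst.
Qed.

(** The failure of admissibility is a strict inequality, stable near [b]. *)
Lemma near_admissible b w : b != 0 -> \forall c \near b, admissible c w ==> admissible b w.
Proof.
move=> b0; elim: w => [|d w IH]; first by near=> c.
have [le1|gt1] := leP (wval b (d :: w)) 1.
  near=> c; apply/implyP => /andP[_ cw]; rewrite /= -wval_cons le1 /=.
  by move: cw; apply/implyP; near: c.
near=> c; rewrite /= -wval_cons leNgt.
have -> //: 1 < wval c (d :: w).
by near: c; exact: (cvgr_gt _ (wval_continuous (w := d :: w) b0) _ gt1).
Unshelve. all: by end_near. Qed.

Lemma near_full b w : b != 0 -> \forall c \near b, full b w ==> full c w.
Proof.
move=> b0; elim: w => [|d w IH]; first by near=> c.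
have [lt1|ge1] := ltP (wval b (d :: w) + b ^- size (d :: w)) 1; last first.
  by near=> c; rewrite /= ltNge ge1.
have cv : (fun c => wval c (d :: w) + c ^- size (d :: w)) @ b -->
    wval b (d :: w) + b ^- size (d :: w).
  apply: cvgD; first exact: wval_continuous.
  by apply: cvgV; [rewrite expf_neq0|exact: exprn_continuous].
near=> c; apply/implyP => /andP[_ fw]; apply/andP; split.
  by near: c; exact: (cvgr_lt _ cv _ lt1).
by move: fw; apply/implyP; near: c.
Unshelve. all: by end_near. Qed.

Lemma near_count (T : Type) (b : R) (P Q : R -> pred T) (s : seq T) :
  (forall w, \forall c \near b, P c w ==> Q c w) ->
  \forall c \near b, (count (P c) s <= count (Q c) s)%N.
Proof.
move=> PQ; elim: s => [|w s IH]; first by near=> c.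
near=> c; rewrite /= leq_add//; last by near: c.
have : P c w ==> Q c w by near: c; exact: PQ.
by case: (P c w) => //= ->.
Unshelve. all: by end_near. Qed.

Lemma powR_continuous_base s b : 0 < b -> {for b, continuous (fun b => b `^ s)}.
Proof.
move=> b0; apply: differentiable_continuous; apply/derivable1_diffP.
by apply: derivable_powR; rewrite in_itv /= b0.
Qed.

Lemma powRX_continuous_base s n b : 0 < b ->
  (fun c => (c `^ s) ^+ n) @ b --> (b `^ s) ^+ n.
Proof.
move=> b0; apply: (@continuous_comp _ _ _ (fun c => c `^ s) (fun x => x ^+ n)).
  exact: powR_continuous_base.
exact: exprn_continuous.
Qed.

Lemma bernoulli_ge (u : R) n : 1 <= u ->
  n.+1%:R * Num.min 1 (u - 1) <= u ^+ n.
Proof.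
move=> u1; elim: n => [|n IH]; first by rewrite mul1r expr0 ge_min lexx.
set d := Num.min _ _ in IH *.
have du : d <= u - 1 by rewrite /d ge_min lexx orbT.
have un : 1 <= u ^+ n by rewrite exprn_ege1.
rewrite -natr1 mulrDl mul1r exprS; apply: (le_trans (lerD IH du)).
rewrite -subr_ge0.
have -> : u * u ^+ n - (u ^+ n + (u - 1)) = (u - 1) * (u ^+ n - 1) by ring.
by rewrite mulr_ge0// subr_ge0.
Qed.

(** A third power, because three factors [u ^+ n] each growing linearly beat a
    square. *)
Lemma quadratic_lt_geometric (u K : R) : 1 < u ->
  exists n, K * n.+1%:R ^+ 2 < (u ^+ 3) ^+ n.
Proof.
move=> u1; pose d := Num.min 1 (u - 1).
have d0 : 0 < d by rewrite lt_min ltr01 subr_gt0.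
have d3 : 0 < d ^+ 3 by rewrite exprn_gt0.
pose n := Num.truncn (K / d ^+ 3); exists n.
have Kn : K < n.+1%:R * d ^+ 3.
  by rewrite -ltr_pdivrMr// truncnS_gt.
have nd : 0 <= n.+1%:R * d by rewrite mulr_ge0// ltW.
rewrite -exprM mulnC exprM.
have : (n.+1%:R * d) ^+ 3 <= (u ^+ n) ^+ 3.
  by rewrite lerXn2r ?nnegrE ?exprn_ge0 ?bernoulli_ge// ltW// (lt_trans ltr01).
apply: lt_le_trans.
have -> : (n.+1%:R * d) ^+ 3 = (n.+1%:R * d ^+ 3) * n.+1%:R ^+ 2 by ring.
by rewrite ltr_pM2r// exprn_gt0.
Qed.

End Continuity.

(** * Continuity of the dimension *)

Section DimensionContinuity.
Variables (R : realType) (A : seq int).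
Hypotheses (A_uniq : uniq A) (A_ge0 : nonneg_word A).

Definition dim_digits (b : R) : \bar R := hausdorff_dim (closure (digit_set b A)).

(** Equality of the two growth rates: the factor [2 (n + 1)^2] is absorbed by any
    increase of the exponent. *)
Lemma count_gap (b s t : R) : 1 < b -> 0 <= s < t ->
  (forall k, (count (full b) (words A k))%:R <= (b `^ s) ^+ k) ->
  exists n, (count (admissible b) (words A n))%:R < (b `^ t) ^+ n.
Proof.
move=> b1 /andP[s0 st] Fs; have b0 := base_gt0 b1.
have bs1 : 1 <= b `^ s by rewrite -(powRr0 b) ler_powR// ltW.
pose u := b `^ ((t - s) / 3).
have u1 : 1 < u.
  have <- : 1 `^ ((t - s) / 3) = 1 :> R by rewrite powR1.
  apply: gt0_ltr_powR; rewrite ?nnegrE ?ltW//.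
  by rewrite divr_gt0// subr_gt0.
have [n Kn] := quadratic_lt_geometric 2 u1; exists n.
apply: le_lt_trans (count_admissible_le b1 A_uniq A_ge0 n bs1 Fs) _.
have -> : b `^ t = u ^+ 3 * b `^ s.
  rewrite -powR_mulrn ?powR_ge0// -powRrM -powRD; last by rewrite (gt_eqF b0) implybT.
  by congr (_ `^ _); field.
by rewrite exprMn ltr_pM2r// exprn_gt0// powR_gt0.
Qed.

(** Strictly between the dimension and [s] there is a [t] for which all [F_k] are
    at most [b^(t k)] by the lower bound; then [N_n < b^(s n)] for some [n], which
    persists near [b] and bounds the dimension there. *)
Lemma dim_digits_near_le (b s : R) : 1 < b -> (dim_digits b < s%:E)%E ->
  \forall c \near b, (dim_digits c <= s%:E)%E.
Proof.
move=> b1 Ds; have b0 := base_gt0 b1.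
have D0 : (0 <= dim_digits b)%E := hausdorff_dim_ge0 _.
have Dfin : dim_digits b \is a fin_num.
  by rewrite ge0_fin_numE// (lt_trans Ds)// ltry.
set r := fine (dim_digits b).
have rE : dim_digits b = r%:E by rewrite fineK.
rewrite rE lte_fin in Ds; rewrite rE lee_fin in D0.
pose t := (r + s) / 2.
have [n Nn] : exists n, (count (admissible b) (words A n))%:R < (b `^ s) ^+ n.
  apply: (@count_gap b t s) => //; first by rewrite /t; apply/andP; split; lra.
  case=> [|k]; first by rewrite /= expr0 lexx.
  rewrite leNgt; apply/negP => /hausdorff_dim_ge_count.
  rewrite -/(dim_digits b) rE lee_fin => /(_ b1 A_uniq A_ge0 isT).
  by rewrite /t => /(_ ltac:(lra)); lra.
have cv := powRX_continuous_base (s := s) (n := n) b0.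
near=> c; have c1 : 1 < c by near: c; exact: (cvgr_gt b).
apply: (@hausdorff_dim_le_count _ c A c1 A_uniq A_ge0 n s); first by lra.
have Nc : (count (admissible c) (words A n) <= count (admissible b) (words A n))%N.
  near: c; apply: (near_count (P := @admissible R)) => w.
  by apply: near_admissible; rewrite gt_eqF.
rewrite (@le_lt_trans _ _ (count (admissible b) (words A n))%:R) ?ler_nat//.
by near: c; exact: (cvgr_gt _ cv _ Nn).
Unshelve. all: by end_near. Qed.

(** If [F_n <= b^(s n)] for all [n], then the dimension is at most any [t > s], by
    the comparison of rates and the upper bound.  So [F_n > b^(s n)] for some [n],
    which persists near [b]. *)
Lemma dim_digits_near_ge (b s : R) : 1 < b -> (s%:E < dim_digits b)%E ->
  \forall c \near b, (s%:E <= dim_digits c)%E.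
Proof.
move=> b1 sD; have b0 := base_gt0 b1.
have [s_lt0|s0] := ltP s 0.
  near=> c; apply: le_trans (hausdorff_dim_ge0 _).
  by rewrite lee_fin ltW.
have [t st tD] : exists2 t, s < t & (t%:E < dim_digits b)%E.
  move: sD; case: (dim_digits b) => [r| |] //=.
    by rewrite lte_fin => sr; exists ((s + r) / 2); rewrite ?lte_fin; lra.
  by move=> _; exists (s + 1); rewrite ?ltry//; lra.
have [n n0 Fn] : exists2 n, (0 < n)%N &
    (b `^ s) ^+ n < (count (full b) (words A n))%:R.
  apply: contrapT => noF.
  have [||n Nn] := @count_gap b s t b1 _ _; first by rewrite s0.
    case=> [|k]; first by rewrite /= expr0 lexx.
    by rewrite leNgt; apply/negP => Fk; apply: noF; exists k.+1.
  have t0 : 0 <= t by rewrite ltW// (le_lt_trans s0).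
  have := hausdorff_dim_le_count b1 A_uniq A_ge0 t0 Nn.
  by rewrite leNgt tD.
have cv := powRX_continuous_base (s := s) (n := n) b0.
near=> c; have c1 : 1 < c by near: c; exact: (cvgr_gt b).
apply: (@hausdorff_dim_ge_count _ c A c1 A_uniq A_ge0 n s) => //.
have Fc : (count (full b) (words A n) <= count (full c) (words A n))%N.
  near: c; apply: (near_count (P := fun=> full b) (Q := @full R)) => w.
  by apply: near_full; rewrite gt_eqF.
rewrite (@lt_le_trans _ _ (count (full b) (words A n))%:R) ?ler_nat//.
by near: c; exact: (cvgr_lt _ cv _ Fn).
Unshelve. all: by end_near. Qed.

Lemma dim_digits_fin_num (b : R) : 1 < b -> dim_digits b \is a fin_num.
Proof.
move=> b1; pose d := Num.min 1 (b - 1).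
have d0 : 0 < d by rewrite lt_min ltr01 subr_gt0.
pose n := Num.truncn ((size A)%:R / d).
have An : (size A)%:R < b ^+ n.
  apply: lt_le_trans (bernoulli_ge n (ltW b1)).
  by rewrite -ltr_pdivrMr// truncnS_gt.
have Dn : (dim_digits b <= n%:R%:E)%E.
  apply: (@hausdorff_dim_le_count _ b A b1 A_uniq A_ge0 1); first exact: ler0n.
  rewrite expr1 powR_mulrn; last by rewrite ltW// base_gt0.
  apply: le_lt_trans An; rewrite ler_nat (leq_trans (count_size _ _))//.
  by rewrite size_words expn1.
rewrite ge0_fin_numE ?(le_lt_trans Dn) ?ltry//.
exact: hausdorff_dim_ge0.
Qed.

Lemma dim_digits_continuous (b : R) : 1 < b -> {for b, continuous dim_digits}.
Proof.
move=> b1; have Dfin := dim_digits_fin_num b1.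
set r := fine (dim_digits b).
have rE : dim_digits b = r%:E by rewrite fineK.
have near_itv e : 0 < e -> \forall c \near b,
    ((r - e)%:E <= dim_digits c <= (r + e)%:E)%E.
  move=> e0; near=> c; apply/andP; split; near: c.
    by apply: dim_digits_near_ge; rewrite // rE lte_fin ltrBlDr ltrDl.
  by apply: dim_digits_near_le; rewrite // rE lte_fin ltrDl.
suff : dim_digits @ b --> r%:E by rewrite -rE.
apply/fine_cvgP; split.
  apply: filterS (near_itv _ ltr01) => c /andP[h1 h2].
  by apply/fin_real/andP; rewrite (lt_le_trans _ h1) ?ltNyr// (le_lt_trans h2) ?ltry.
apply/cvgrPdist_le => e e0; apply: filterS (near_itv _ e0) => c /=.
case: (dim_digits c) => [x| /andP[_] | /andP[+ _]]; last 2 first.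
- by rewrite leNgt ltry.
- by rewrite leNgt ltNyr.
by rewrite !lee_fin /= distrC ler_distl.
Unshelve. all: by end_near. Qed.

End DimensionContinuity.

Lemma beta_cantorE (R : realType) (b : R) q (theta : 'I_q -> int) :
  beta_cantor b theta = closure (digit_set b [seq theta i | i <- enum 'I_q]).
Proof.
congr closure; apply/seteqP; split=> x [x01 dig]; split=> // k /dig.
  by move=> [i ->]; rewrite map_f// mem_enum.
by move=> /mapP[i _ ->]; exists i.
Qed.

Theorem theorem3 (R : realType) (m : nat) (theta : 'I_m.+1 -> int)
    (theta_ge0 : 0 <= theta ord0)
    (theta_lt : forall i j : 'I_m.+1, (i < j)%N -> theta i < theta j) :
  {within [set b : R | 2 < b /\ (theta ord_max)%:~R < b],
    continuous (fun b : R => hausdorff_dim (beta_cantor b theta))}.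
Proof.
apply: continuous_in_subspaceT => b; rewrite inE /= => -[b2 _].
under eq_fun do rewrite beta_cantorE.
apply: dim_digits_continuous; last by lra.
  rewrite map_inj_uniq ?enum_uniq// => i j tij.
  by apply/val_inj; case: (ltngtP i j) => // /theta_lt; rewrite tij ltxx.
apply/allP => _ /mapP[i _ ->].
have [/eqP i0|i0] := posnP i; first by have /eqP -> : i == ord0 by [].
by apply: le_trans theta_ge0 (ltW _); apply: theta_lt.
Qed.
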